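(* Under the assumptions in the context, follow the Markovian sampling strategy of the actor-critic algorithm described in the context, with step sizes $\eta^\theta_t,\eta^\omega_t$, and let $\hat\nu_t$ denote the probability distribution of the state $s_t$ induced by this process. Then for any $t\ge0$, $$\mathbb E\big\|\hat\nu_t-\nu^{\pi_{\theta_t}}_\rho\big\|_1\le L\,C_\delta\,L_\nu\sum_{k=0}^{t-1}\gamma^{t-1-k}\eta^\theta_k+\gamma^t\big\|\rho-\nu^{\pi_{\theta_0}}_\rho\big\|_1 ,$$ where $L$, $C_\delta$ and $L_\nu$ are the constants described in the context.
   Context: **MDP.** $\mathcal S$ is the state space and $\mathcal A$ the action space; distributions are identified with densities and $\|f\|_1=\int_{\mathcal S}|f(s)|\,ds$. $\mathcal P(\cdot|s,a)$ is the transition kernel, $\gamma\in(0,1)$ the discount factor, $\rho$ the initial state distribution. Policies $\pi_\theta(\cdot|s)$ are parameterized by $\theta$ in a parameter set $\Omega(\theta)$. The discounted visitation distribution is $\nu^{\pi_\theta}_\rho(s)=(1-\gamma)\sum_{t\ge0}\gamma^t\Pr(s_t=s)$ for the chain $s_0\sim\rho$, $a_t\sim\pi_\theta(\cdot|s_t)$, $s_{t+1}\sim\mathcal P(\cdot|s_t,a_t)$. **Reward.** The reward parameter $\varphi$ ranges over a parameter set $\Omega(\varphi)$ and comprises everything that, together with $\theta$, determines the regularized reward $\tilde r_{\varphi,\theta}(s,a)=r(s,a)-\alpha\log\pi_\theta(a|s)$ (the base reward $r$ and the coefficient $\alpha\ge0$ are determined by $\varphi$). **Linear critic.** $\phi:\mathcal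 S\to\mathbb R^d$ is a feature map with $\|\phi(s)\|_2\le1$. For $s\sim\nu^{\pi_\theta}_\rho$, $a\sim\pi_\theta(\cdot|s)$, $s'\sim\mathcal P(\cdot|s,a)$, put $A_\theta=\mathbb E[\phi(s)(\phi(s)-\gamma\phi(s'))^\top]$, $b_{\varphi,\theta}=\mathbb E[\tilde r_{\varphi,\theta}(s,a)\phi(s)]$ and $\omega^*(\varphi,\theta)=A_\theta^{-1}b_{\varphi,\theta}$. **Assumptions.** - Sufficient exploration: there is $\lambda>0$ with $x^\top A_\theta x\ge\lambda\|x\|_2^2$ for all $x\in\mathbb R^d$, $\theta\in\Omega(\theta)$. - Policy Lipschitz: there are constants $L,S$ with $\|\nabla_\theta\log\pi_\theta(a|s)\|_2\le L$ and $\|\nabla^2_\theta\log\pi_\theta(a|s)\|_2\le S$ for all $\theta\in\Omega(\theta)$, $s\in\mathcal S$, $a\in\mathcal A$. - Regularized reward: there are $C,D>0$ such that for all $\theta\in\Omega(\theta)$, $\varphi\in\Omega(\varphi)$, $s\in\mathcal S$, writing $R=\mathbb E_{a\sim\pi_\theta(\cdot|s)}[\tilde r_{\varphi,\theta}(s,a)]$: $|R|\le C$; $\mathbb E_{a\sim\pi_\theta(\cdot|s)}[\tilde r_{\varphi,\theta}(s,a)^2]\le C^2$; $\|\nabla_\theta R\|_2\le CL$; $\|\nabla^2_\theta R\|_2\le C(L^2+S)$; $\|\nabla_\varphi R\|_2\le D$. **Constants.** $C_\omega$ is a constant with $\|\omega^*(\varphi,\theta)\|_2\le C_\omega$ for all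 $\varphi,\theta$. $L_\nu$ is a constant such that $\theta\mapsto\nu^{\pi_\theta}_\rho$ is $L_\nu$-Lipschitz in $\|\cdot\|_1$. $C_\delta$ is a constant such that $\mathbb E_{s\sim\nu,\,a\sim\pi_\theta(\cdot|s),\,s'\sim\mathcal P(\cdot|s,a)}\big[(\tilde r_{\varphi,\theta}(s,a)+(\gamma\phi(s')-\phi(s))^\top\omega)^2\big]\le C_\delta^2$ for every state distribution $\nu$, every $\theta\in\Omega(\theta)$, $\varphi\in\Omega(\varphi)$ and every $\omega$ with $\|\omega\|_2\le C_\omega$. **Algorithm.** Let $\widehat{\mathcal P}(\cdot|s,a)=\gamma\mathcal P(\cdot|s,a)+(1-\gamma)\rho(\cdot)$. Given initial $\theta_0,\omega_0,\varphi_0$, sample $s_0\sim\rho$. For $t=0,1,2,\dots$: sample $a_t\sim\pi_{\theta_t}(\cdot|s_t)$, $s_t'\sim\mathcal P(\cdot|s_t,a_t)$, $s_{t+1}\sim\widehat{\mathcal P}(\cdot|s_t,a_t)$; set $\hat\delta_t=\tilde r_{\varphi_t,\theta_t}(s_t,a_t)+(\gamma\phi(s_t')-\phi(s_t))^\top\omega_t$; set $\theta_{t+1}=\theta_t+\eta^\theta_t\hat\delta_t\nabla_\theta\log\pi_{\theta_t}(a_t|s_t)$; set $\omega_{t+1}=\mathrm{Proj}_{C_\omega}(\omega_t+\eta^\omega_t\hat\delta_t\phi(s_t))$, where $\mathrm{Proj}_{C_\omega}$ is the projection keeping the norm bounded by $C_\omega$; and obtain $\varphi_{t+1}$ from $\varphi_t$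 by an arbitrary update rule. The expectation in the claim is over the randomness of the algorithm.
   Formalization: The distribution of s_t is read as the random law at time t of the chain run with the realised parameters θ_0, θ_1, … held fixed (for the marginal law of s_t the claim fails at t=2); ‖ω_0‖ ≤ C_ω and nonnegative step sizes are assumed; C_δ covers all state laws, point masses included. *)

(* Defs.v *)
From HB Require Import structures.
From mathcomp Require Import all_boot all_order all_algebra.
From mathcomp Require Import all_classical all_reals all_analysis.
Set Implicit Arguments.
Unset Strict Implicit.
Unset Printing Implicit Defensive.
Import Order.TTheory GRing.Theory Num.Theory.
Import numFieldNormedType.Exports.
Local Open Scope classical_set_scope.
Local Open Scope ring_scope.

Notation borel X := (g_sigma_algebraType (@open X)).

Section Euclidean.
Context {R : realType}.

(* The library norm `|x| on matrices is the max norm, hence this one. *)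
Definition enorm n (x : 'cV[R]_n) : R := Num.sqrt (\sum_i x i ord0 ^+ 2).

Definition opnorm n (H : 'M[R]_n) : R :=
  sup [set enorm (H *m x) | x in [set x : 'cV[R]_n | enorm x <= 1]].

Definition proj_ball n (c : R) (x : 'cV[R]_n) : 'cV[R]_n :=
  if enorm x <= c then x else (c / enorm x) *: x.

Definition grad n (f : 'cV[R]_n -> R) (x : 'cV[R]_n) : 'cV[R]_n :=
  \col_i 'D_(delta_mx i ord0 : 'cV[R]_n) f x.

Definition hess n (f : 'cV[R]_n -> R) (x : 'cV[R]_n) : 'M[R]_n :=
  \matrix_(i, j) grad (fun y => grad f y i ord0) x j ord0.

Definition twice_differentiable n (f : 'cV[R]_n -> R) (x : 'cV[R]_n) : Prop :=
  (\forall y \near x, differentiable f y) /\ differentiable (grad f) x.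

End Euclidean.

Section Densities.
Context {R : realType} {d : measure_display} {X : measurableType d}.
Variable mu : {measure set X -> \bar R}.

Definition is_density (f : X -> R) : Prop :=
  [/\ measurable_fun setT f, (forall x, 0 <= f x)
    & (\int[mu]_x (f x)%:E = 1)%E].

(* Densities obtained by integration are kept \bar R-valued; they are finite
   almost everywhere. *)
Definition l1dist (f g : X -> \bar R) : \bar R :=
  (\int[mu]_x `|f x - g x|)%E.

End Densities.

Section MDP.
Context {R : realType} {dS dA : measure_display}.

(* [refS] and [refA] are the reference measures with respect to which
   densities on states and actions are taken (e.g. Lebesgue or counting). *)
Record mdp (S : measurableType dS) (A : measurableType dA) := MDP {
  refS : {sigma_finite_measure set S -> \bar R} ;
  refA : {sigma_finite_measure set A -> \bar R} ;
  trans : S -> A -> S -> R ;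
  init : S -> R ;
  disc : R ;
  trans_density : forall s a, is_density refS (trans s a) ;
  trans_measurable :
    measurable_fun setT (fun x : S * A * S => trans x.1.1 x.1.2 x.2) ;
  init_density : is_density refS init ;
  disc_bounds : 0 < disc < 1
}.

Context {S : measurableType dS} {A : measurableType dA} (M : mdp S A).
Local Notation gamma := (disc M).

(* State density at time t of the chain s_0 ~ init, a_k ~ pol k (. | s_k),
   s_(k+1) ~ q (. | s_k, a_k). *)
Fixpoint state_density (q : S -> A -> S -> R) (pol : nat -> S -> A -> R)
    (t : nat) : S -> \bar R :=
  if t is k.+1 then
    fun s' => (\int[refS M]_s (state_density q pol k s *
                 \int[refA M]_a (pol k s a * q s a s')%:E))%E
  else fun s => (init M s)%:E.

Definition visitation (pol : S -> A -> R) (s : S) : \bar R :=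
  ((1 - gamma)%:E * \sum_(0 <= t <oo)
     ((gamma ^+ t)%:E * state_density (trans M) (fun=> pol) t s))%E.

Definition reset_trans (s : S) (a : A) (s' : S) : R :=
  gamma * trans M s a s' + (1 - gamma) * init M s'.

Definition next_prob (q : S -> A -> S -> R) (s : S) (a : A) (B : set S)
    : \bar R := (\int[refS M]_(s' in B) (q s a s')%:E)%E.

(* Expectation of f a s' for a ~ pol (. | s), s' ~ trans (. | s, a). *)
Definition step_mean (pol : S -> A -> R) (s : S) (f : A -> S -> R) : \bar R :=
  (\int[refA M]_a ((pol s a)%:E *
     \int[refS M]_s' (trans M s a s' * f a s')%:E))%E.

Definition visit_mean (pol : S -> A -> R) (f : S -> A -> S -> R) : R :=
  fine (\int[refS M]_s (visitation pol s * step_mean pol s (f s)))%E.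

Context {p q d : nat}.
Variables (Theta : set 'cV[R]_p) (Phi : set 'cV[R]_q).
Variable pi : 'cV[R]_p -> S -> A -> R.
Variables (r : 'cV[R]_q -> S -> A -> R) (alpha : 'cV[R]_q -> R).
Variable feat : S -> 'cV[R]_d.

Definition policy_class : Prop :=
  measurable_fun setT
    (fun x : borel 'cV[R]_p * (S * A) => pi x.1 x.2.1 x.2.2) /\
  forall theta, Theta theta -> forall s,
    (forall a, 0 < pi theta s a) /\ is_density (refA M) (pi theta s).

Definition reward_class : Prop :=
  [/\ measurable_fun setT
        (fun x : borel 'cV[R]_q * (S * A) => r x.1 x.2.1 x.2.2),
      measurable_fun setT (alpha : borel 'cV[R]_q -> R)
    & forall phi, Phi phi -> 0 <= alpha phi].

Definition reg_reward (phi : 'cV[R]_q) (theta : 'cV[R]_p) (s : S) (a : A) : R :=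
  r phi s a - alpha phi * ln (pi theta s a).

Definition mean_reward (phi : 'cV[R]_q) (theta : 'cV[R]_p) (s : S) : R :=
  \int[refA M]_a (pi theta s a * reg_reward phi theta s a).

Definition feature_map : Prop :=
  measurable_fun setT (feat : S -> borel 'cV[R]_d) /\
  forall s, enorm (feat s) <= 1.

Definition critic_mx (theta : 'cV[R]_p) : 'M[R]_d :=
  \matrix_(i, j) visit_mean (pi theta)
    (fun s _ s' => (feat s *m (feat s - gamma *: feat s')^T) i j).

Definition critic_vec (phi : 'cV[R]_q) (theta : 'cV[R]_p) : 'cV[R]_d :=
  \col_i visit_mean (pi theta)
    (fun s a _ => (reg_reward phi theta s a *: feat s) i ord0).

Definition critic_opt (phi : 'cV[R]_q) (theta : 'cV[R]_p) : 'cV[R]_d :=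
  invmx (critic_mx theta) *m critic_vec phi theta.

Definition td_error (phi : 'cV[R]_q) (theta : 'cV[R]_p) (omega : 'cV[R]_d)
    (s : S) (a : A) (s' : S) : R :=
  reg_reward phi theta s a +
  ((gamma *: feat s' - feat s)^T *m omega) ord0 ord0.

Definition log_policy (s : S) (a : A) (theta : 'cV[R]_p) : R :=
  ln (pi theta s a).

Definition sufficient_exploration : Prop :=
  exists2 lambda : R, 0 < lambda &
    forall theta, Theta theta -> forall x : 'cV[R]_d,
      lambda * enorm x ^+ 2 <= (x^T *m critic_mx theta *m x) ord0 ord0.

Definition policy_lipschitz (L Sm : R) : Prop :=
  forall theta s a, Theta theta ->
    [/\ twice_differentiable (log_policy s a) theta,
        enorm (grad (log_policy s a) theta) <= L
      & opnorm (hess (log_policy s a) theta) <= Sm].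

Definition regularized_reward (L Sm C D : R) : Prop :=
  forall theta phi s, Theta theta -> Phi phi ->
    [/\ `|mean_reward phi theta s| <= C,
        (\int[refA M]_a (pi theta s a * reg_reward phi theta s a ^+ 2)%:E
           <= (C ^+ 2)%:E)%E,
        [/\ twice_differentiable (fun th => mean_reward phi th s) theta,
            enorm (grad (fun th => mean_reward phi th s) theta) <= C * L
          & opnorm (hess (fun th => mean_reward phi th s) theta)
              <= C * (L ^+ 2 + Sm)]
      & differentiable (fun ph => mean_reward ph theta s) phi /\
        enorm (grad (fun ph => mean_reward ph theta s) phi) <= D].

Definition critic_bound (Comega : R) : Prop :=
  forall phi theta, Phi phi -> Theta theta ->
    enorm (critic_opt phi theta) <= Comega.

Definition visitation_lipschitz (Lnu : R) : Prop :=
  0 <= Lnu /\ forall theta theta', Theta theta -> Theta theta' ->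
    (l1dist (refS M) (visitation (pi theta)) (visitation (pi theta'))
       <= (Lnu * enorm (theta - theta'))%:E)%E.

(* The state distribution ranges over all probability measures on S, not
   only over those with a density. *)
Definition td_error_bound (Comega Cdelta : R) : Prop :=
  0 <= Cdelta /\
  forall (nu : probability S R) theta phi (omega : 'cV[R]_d),
    Theta theta -> Phi phi -> enorm omega <= Comega ->
    (\int[nu]_s step_mean (pi theta) s
       (fun a s' => (td_error phi theta omega s a s' ^+ 2)%R)
     <= (Cdelta ^+ 2)%:E)%E.

(* [F t] is the information available once s_t, theta_t, omega_t and phi_t are
   known; it may contain more than the history of these variables, so that
   phi_(t+1) may use any data seen so far as well as extra randomness. *)
Record actor_critic (Comega : R) (eta_theta eta_omega : nat -> R)
    (theta0 : 'cV[R]_p) (omega0 : 'cV[R]_d) (phi0 : 'cV[R]_q)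
    {dT : measure_display} {T : measurableType dT} (Pr : probability T R)
    (F : nat -> set (set T)) (s : nat -> T -> S) (a : nat -> T -> A)
    (s' : nat -> T -> S) (theta : nat -> T -> 'cV[R]_p)
    (omega : nat -> T -> 'cV[R]_d) (phi : nat -> T -> 'cV[R]_q) : Prop :=
  ActorCritic {
    ac_filtration : forall t,
      [/\ sigma_algebra setT (F t), F t `<=` F t.+1 & F t `<=` measurable] ;
    ac_state_adapted : forall t B, measurable B -> F t (s t @^-1` B) ;
    ac_param_adapted : forall t,
      [/\ (forall B : set (borel 'cV[R]_p), measurable B ->
             F t (theta t @^-1` B)),
          (forall B : set (borel 'cV[R]_d), measurable B ->
             F t (omega t @^-1` B))
        & (forall B : set (borel 'cV[R]_q), measurable B ->
             F t (phi t @^-1` B))] ;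
    ac_action_adapted : forall t B, measurable B -> F t.+1 (a t @^-1` B) ;
    ac_next_adapted : forall t B, measurable B -> F t.+1 (s' t @^-1` B) ;
    ac_params_in : forall t w, Theta (theta t w) /\ Phi (phi t w) ;
    ac_params_init : forall w,
      [/\ theta 0%N w = theta0, omega 0%N w = omega0 & phi 0%N w = phi0] ;
    ac_state_init : forall B, measurable B ->
      (Pr (s 0%N @^-1` B) = \int[refS M]_(x in B) (init M x)%:E)%E ;
    (* Conditionally on F t, a_t ~ pi_(theta_t) (. | s_t); given a_t, s'_t and
       s_(t+1) are independent with laws trans and reset_trans. *)
    ac_sampling : forall t E (B : set A) (C C' : set S),
      F t E -> measurable B -> measurable C -> measurable C' ->
      (Pr (E `&` (a t @^-1` B) `&` (s' t @^-1` C) `&` (s t.+1 @^-1` C')) =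
       \int[Pr]_(w in E) \int[refA M]_(x in B)
         ((pi (theta t w) (s t w) x)%:E * next_prob (trans M) (s t w) x C
            * next_prob reset_trans (s t w) x C'))%E ;
    ac_theta_update : forall t w,
      theta t.+1 w = theta t w +
        (eta_theta t *
         td_error (phi t w) (theta t w) (omega t w) (s t w) (a t w) (s' t w))
        *: grad (log_policy (s t w) (a t w)) (theta t w) ;
    ac_omega_update : forall t w,
      omega t.+1 w = proj_ball Comega (omega t w +
        (eta_omega t *
         td_error (phi t w) (theta t w) (omega t w) (s t w) (a t w) (s' t w))
        *: feat (s t w))
  }.

(* Distribution of s_t induced by following the Markovian sampling strategy
   with the policy parameters th 0, th 1, ...; evaluated along the random
   parameters of a run it is a random density. *)
Definition sampling_density (th : nat -> 'cV[R]_p) (t : nat) : S -> \bar R :=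
  state_density reset_trans (fun k => pi (th k)) t.

End MDP.

Arguments mdp R {dS dA} S A.

(* Main.v *)
From HB Require Import structures.
Require Import Defs.
From mathcomp Require Import all_boot all_order all_algebra.
From mathcomp Require Import all_classical all_reals all_analysis.
From mathcomp Require Import measurable_realfun lra ring.
Set Implicit Arguments.
Unset Strict Implicit.
Unset Printing Implicit Defensive.
Import Order.TTheory GRing.Theory Num.Theory.
Import numFieldNormedType.Exports.
Local Open Scope classical_set_scope.
Local Open Scope ring_scope.

(**
The state density is pushed forward at time k by the kernel of the policy pi_(theta_k) followed by the reset transition gamma * P + (1 - gamma) * rho. Between densities of mass 1 this push is a gamma-contraction in L1, because the reset part cancels, and the visitation density of a policy is a fixed point of its own push. Hence the distance D_t between the state density and the visitation density of theta_t satisfies, along every run,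
  D_(t+1) <= gamma * D_t + Lnu * |theta_(t+1) - theta_t| <= gamma * D_t + Lnu * L * eta_t * |delta_t|.
Unrolling and taking expectations leaves E|delta_t| <= Cdelta to be shown. By sampling, the conditional second moment of delta_t is its mean over one step from s_t with fixed parameters; the bound assumed for all state distributions, read at the Dirac mass in s_t, bounds it by Cdelta^2.
*)

Ltac measurable_proj :=
  repeat first [ exact: measurable_id | exact: measurable_fst
    | exact: measurable_snd | apply: measurable_fun_pair
    | apply: (measurableT_comp measurable_fst)
    | apply: (measurableT_comp measurable_snd) ].

(** The factor may be [+oo], as happens when it is a value of a transition density obtained by
    integration. In that case either all terms vanish and both sides are 0, or one term is positive
    and both sides are [+oo]. *)
Lemma nneseriesZl_ereal (R : realType) (f : nat -> \bar R) (k : \bar R) :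
  (0 <= k -> (forall n, 0 <= f n) ->
   \sum_(0 <= n <oo) (k * f n) = k * \sum_(0 <= n <oo) f n)%E.
Proof.
case: k => [x| |//] _ f0; first by rewrite nneseriesZl.
have [f_eq0|/existsNP[n /eqP fn_neq0]] := pselect (forall n, f n = 0%E).
  by rewrite !eseries0 ?mule0// => n _ _; rewrite f_eq0 ?mule0.
have fn_gt0 : (0 < f n)%E by rewrite lt0e fn_neq0 f0.
rewrite gt0_mulye; last first.
  by apply: lt_le_trans fn_gt0 _; rewrite (nneseriesD1 (n := n))// leeDl ?nneseries_ge0.
rewrite (nneseries_pinfty (k := n))// ?gt0_mulye// => m _.
by rewrite mule_ge0// leey.
Qed.

(** * L1 distance between extended-real functions *)

Section L1dist.
Local Open Scope ereal_scope.
Context {R : realType} {d : measure_display} {X : measurableType d}.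
Variable mu : {measure set X -> \bar R}.
Implicit Types f g h : X -> \bar R.

(** By the convention that a difference of equal infinities is [-oo], [|x - y|] is [+oo] as soon as
    x or y is infinite. The infinite cases therefore hold trivially. *)
Lemma lee_abseB_triangle (x y z : \bar R) : `|x - z| <= `|x - y| + `|y - z|.
Proof.
case: x => [x| |]; case: y => [y| |]; case: z => [z| |] //=;
  rewrite ?leey ?leNye // -?EFinD ?lee_fin //.
exact: ler_distD.
Qed.

Lemma lee_addl_abseB (x y : \bar R) : 0 <= x -> 0 <= y -> x <= y + `|x - y|.
Proof.
case: x => [x| |]; case: y => [y| |] //=; rewrite ?leey // ?lee_fin => _ _.
by rewrite -lerBlDl ler_norm.
Qed.

Lemma lee_addr_abseB (x y : \bar R) : 0 <= x -> 0 <= y -> y <= x + `|x - y|.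
Proof.
case: x => [x| |]; case: y => [y| |] //=; rewrite ?leey // ?lee_fin => _ _.
by rewrite -lerBlDl distrC ler_norm.
Qed.

(** The finite shift [c] cancels even at infinite values. This is how the common reset term
    disappears from the difference of two pushes. *)
Lemma abseB_affine (k c : R) (x y : \bar R) : (0 < k)%R ->
  `|(k%:E * x + c%:E) - (k%:E * y + c%:E)| = k%:E * `|x - y|.
Proof.
move=> k0; have kE : (0 < k%:E) by rewrite lte_fin.
case: x => [x| |]; case: y => [y| |];
  rewrite ?(gt0_muley kE) ?(gt0_muleNy kE) //= ?(gt0_muley kE) //.
by rewrite -EFinM opprD addrACA subrr addr0 -mulrBr normrM (gtr0_norm k0).
Qed.

Lemma measurable_abseB f g : measurable_fun setT f -> measurable_fun setT g ->
  measurable_fun setT (fun x => `|f x - g x|).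
Proof.
by move=> mf mg; apply: measurableT_comp => //; exact: emeasurable_funB.
Qed.

Lemma l1dist_ge0 f g : 0 <= l1dist mu f g.
Proof. exact: integral_ge0. Qed.

Lemma l1dist_triangle f g h : measurable_fun setT f -> measurable_fun setT g ->
  measurable_fun setT h -> l1dist mu f h <= l1dist mu f g + l1dist mu g h.
Proof.
move=> mf mg mh; rewrite /l1dist -ge0_integralD//; try exact: measurable_abseB.
apply: ge0_le_integral => //; first exact: measurable_abseB.
  by apply: emeasurable_funD; exact: measurable_abseB.
by move=> x _; exact: lee_abseB_triangle.
Qed.

End L1dist.

(** * One-step kernels and their action on state densities *)

Section Transition.
Local Open Scope ereal_scope.
Context {R : realType} {dS dA : measure_display}.
Context {S : measurableType dS} {A : measurableType dA} (M : mdp R S A).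
Local Notation gamma := (disc M).
Implicit Types (pol : S -> A -> R) (q : S -> A -> S -> R) (f g : S -> \bar R).

Definition policy_density pol : Prop :=
  measurable_fun setT (fun x : S * A => pol x.1 x.2) /\
  forall s, is_density (refA M) (pol s).

Definition transition_density q : Prop :=
  measurable_fun setT (fun x : S * A * S => q x.1.1 x.1.2 x.2) /\
  forall s a, is_density (refS M) (q s a).

Lemma transition_density_trans : transition_density (trans M).
Proof. by split; [exact: trans_measurable|exact: trans_density]. Qed.

Lemma transition_density_reset : transition_density (reset_trans M).
Proof.
have [mi i0 i1] := init_density M; have /andP[g0 g1] := disc_bounds M.
split=> [|s a].
  apply: measurable_funD; apply: measurable_funM => //.
    exact: trans_measurable.
  by apply: (measurableT_comp mi).
have [mt t0 t1] := trans_density M s a; split.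
- by apply: measurable_funD; apply: measurable_funM.
- by move=> x; rewrite addr_ge0// mulr_ge0// ?subr_ge0// ltW.
- under eq_integral do rewrite /reset_trans EFinD !EFinM.
  rewrite ge0_integralD//; last 4 first.
  + by move=> x _; rewrite -EFinM lee_fin mulr_ge0// ltW.
  + by apply/measurable_EFinP; apply: measurable_funM.
  + by move=> x _; rewrite -EFinM lee_fin mulr_ge0// subr_ge0 ltW.
  + by apply/measurable_EFinP; apply: measurable_funM.
  rewrite !ge0_integralZl//; last 6 first.
  + exact/measurable_EFinP.
  + by move=> x _; rewrite lee_fin.
  + by rewrite lee_fin subr_ge0 ltW.
  + exact/measurable_EFinP.
  + by move=> x _; rewrite lee_fin.
  + by rewrite lee_fin ltW.
  by rewrite t1 i1 !mule1 -EFinD addrC subrK.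
Qed.

(** The state-to-state transition density, with the action averaged out. It is extended-real because
    the integral over actions may diverge at some points. *)
Definition kern pol q (s s' : S) : \bar R :=
  \int[refA M]_a (pol s a * q s a s')%:E.

(** The law of the next state when the current one has density [f], that is, one step of the
    recursion defining [state_density]. *)
Definition push pol q f (s' : S) : \bar R :=
  \int[refS M]_s (f s * kern pol q s s').

Section kern.
Variables (pol : S -> A -> R) (q : S -> A -> S -> R).
Hypotheses (Hpol : policy_density pol) (Hq : transition_density q).

Let mK3 : measurable_fun setT
  (fun x : S * S * A => (pol x.1.1 x.2 * q x.1.1 x.2 x.1.2)%:E).
Proof.
apply/measurable_EFinP; apply: measurable_funM.
  apply: (measurableT_comp (f := fun x : S * A => pol x.1 x.2)
    (g := fun x : S * S * A => (x.1.1, x.2)) Hpol.1); measurable_proj.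
apply: (measurableT_comp (f := fun x : S * A * S => q x.1.1 x.1.2 x.2)
  (g := fun x : S * S * A => (x.1.1, x.2, x.1.2)) Hq.1); measurable_proj.
Qed.

Let K3_ge0 s a s' : 0 <= (pol s a * q s a s')%:E.
Proof.
have [_ p0 _] := Hpol.2 s; have [_ q0 _] := Hq.2 s a.
by rewrite lee_fin mulr_ge0.
Qed.

Lemma kern_ge0 s s' : 0 <= kern pol q s s'.
Proof. by apply: integral_ge0 => a _. Qed.

Lemma measurable_kern : measurable_fun setT (fun x : S * S => kern pol q x.1 x.2).
Proof.
exact: (measurable_fun_fubini_tonelli_F (m2 := refA M)
  (fun x : S * S * A => (pol x.1.1 x.2 * q x.1.1 x.2 x.1.2)%:E)).
Qed.

(** Tonelli lets the next state be integrated first, where [q s a] has mass 1; what remains is the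
    mass of [pol s]. *)
Lemma integral_kern s : \int[refS M]_s' kern pol q s s' = 1.
Proof.
have [mp p0 p1] := Hpol.2 s.
rewrite /kern (fubini_tonelli (m1 := refS M) (m2 := refA M)
  (fun x : S * A => (pol s x.2 * q s x.2 x.1)%:E))//=; last first.
  apply: (measurableT_comp (g := fun x : S * A => (s, x.1, x.2)) mK3).
  by measurable_proj; exact: measurable_cst.
rewrite -p1; apply: eq_integral => a _.
have [mq q0 q1] := Hq.2 s a.
under eq_integral do rewrite EFinM.
rewrite ge0_integralZl// ?q1 ?mule1// ?lee_fin//.
- exact/measurable_EFinP.
- by move=> x _; rewrite lee_fin.
Qed.

Let measurable_pushI f : measurable_fun setT f ->
  measurable_fun setT (fun x : S * S => f x.2 * kern pol q x.2 x.1).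
Proof.
move=> mf; apply: emeasurable_funM; first by apply: (measurableT_comp mf).
apply: (measurableT_comp (g := fun x : S * S => (x.2, x.1)) measurable_kern).
by measurable_proj.
Qed.

Let measurable_pushI1 f s' : measurable_fun setT f ->
  measurable_fun setT (fun s => f s * kern pol q s s').
Proof.
move=> mf.
apply: (measurableT_comp (g := fun s : S => (s', s)) (measurable_pushI mf)).
by measurable_proj; exact: measurable_cst.
Qed.

Lemma push_ge0 f : (forall s, 0 <= f s) -> forall s', 0 <= push pol q f s'.
Proof.
by move=> f0 s'; apply: integral_ge0 => s _; rewrite mule_ge0 ?kern_ge0.
Qed.

Lemma measurable_push f : (forall s, 0 <= f s) -> measurable_fun setT f ->
  measurable_fun setT (push pol q f).
Proof.
move=> f0 mf; apply: (measurable_fun_fubini_tonelli_F (m2 := refS M)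
  (fun x : S * S => f x.2 * kern pol q x.2 x.1)); first exact: measurable_pushI.
by move=> x; rewrite mule_ge0 ?kern_ge0.
Qed.

(** Conservation of mass: by Tonelli the kernel is integrated over the arrival state first and
    contributes the factor 1. *)
Lemma integral_push f : (forall s, 0 <= f s) -> measurable_fun setT f ->
  \int[refS M]_s' push pol q f s' = \int[refS M]_s f s.
Proof.
move=> f0 mf; rewrite /push (fubini_tonelli (m1 := refS M) (m2 := refS M)
  (fun x : S * S => f x.2 * kern pol q x.2 x.1))//=; last 2 first.
- exact: measurable_pushI.
- by move=> x; rewrite mule_ge0 ?kern_ge0.
apply: eq_integral => s _; rewrite ge0_integralZl// ?integral_kern ?mule1//.
- apply: (measurableT_comp (g := fun s' : S => (s, s')) measurable_kern).
  by measurable_proj; exact: measurable_cst.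
- by move=> x _; exact: kern_ge0.
Qed.

Lemma pushD f g : (forall s, 0 <= f s) -> measurable_fun setT f ->
  (forall s, 0 <= g s) -> measurable_fun setT g ->
  forall s', push pol q (fun s => f s + g s) s' = push pol q f s' + push pol q g s'.
Proof.
move=> f0 mf g0 mg s'; rewrite /push -ge0_integralD//; last 4 first.
- by move=> s _; rewrite mule_ge0 ?kern_ge0.
- exact: measurable_pushI1.
- by move=> s _; rewrite mule_ge0 ?kern_ge0.
- exact: measurable_pushI1.
by apply: eq_integral => s _; rewrite ge0_muleDl.
Qed.

Lemma le_push f g : (forall s, 0 <= f s) -> measurable_fun setT f ->
  measurable_fun setT g -> (forall s, f s <= g s) ->
  forall s', push pol q f s' <= push pol q g s'.
Proof.
move=> f0 mf mg fg s'; apply: ge0_le_integral => //.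
- by move=> s _; rewrite mule_ge0 ?kern_ge0.
- exact: measurable_pushI1.
- exact: measurable_pushI1.
- by move=> s _; rewrite lee_wpmul2r ?kern_ge0.
Qed.

(** All terms are nonnegative, so the integral passes through the series. Pulling the possibly
    infinite kernel value through the sum is the use of [nneseriesZl_ereal]. *)
Lemma push_nneseries (c : R) (f_ : nat -> S -> \bar R) : (0 <= c)%R ->
  (forall n s, 0 <= f_ n s) -> (forall n, measurable_fun setT (f_ n)) ->
  forall s', push pol q (fun s => c%:E * \sum_(0 <= n <oo) f_ n s) s' =
    c%:E * \sum_(0 <= n <oo) push pol q (f_ n) s'.
Proof.
move=> c0 f0 mf s'; rewrite /push -integral_nneseries//; last 2 first.
- by move=> n; exact: measurable_pushI1.
- by move=> n s _; rewrite mule_ge0 ?kern_ge0.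
rewrite -ge0_integralZl//; last 2 first.
- apply: ge0_emeasurable_sum => [n s _ _|n _]; last exact: measurable_pushI1.
  by rewrite mule_ge0 ?kern_ge0.
- by move=> s _; apply: nneseries_ge0 => n _ _; rewrite mule_ge0 ?kern_ge0.
apply: eq_integral => s _; rewrite -muleA; congr (_ * _).
rewrite muleC -nneseriesZl_ereal ?kern_ge0//.
by apply: eq_eseriesr => n _; rewrite muleC.
Qed.

(* Writing h = |f - g|, positivity gives push f <= push g + push h and
   conversely, so that h may take infinite values. *)
Lemma l1dist_push f g : (forall s, 0 <= f s) -> measurable_fun setT f ->
  \int[refS M]_s f s < +oo ->
  (forall s, 0 <= g s) -> measurable_fun setT g -> \int[refS M]_s g s < +oo ->
  l1dist (refS M) (push pol q f) (push pol q g) <= l1dist (refS M) f g.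
Proof.
move=> f0 mf foo g0 mg goo; pose h s := `|f s - g s|.
have mh : measurable_fun setT h by exact: measurable_abseB.
have h0 s : 0 <= h s by exact: abse_ge0.
(* A pushed density keeps its finite mass and is therefore finite almost everywhere; only at such
   points do the two one-sided bounds below combine into a bound on the absolute difference. *)
have fin k : (forall s, 0 <= k s) -> measurable_fun setT k ->
    \int[refS M]_s k s < +oo ->
    {ae refS M, forall s, setT s -> push pol q k s \is a fin_num}.
  move=> k0 mk koo; apply: integrable_ae => //; apply/integrableP; split.
    exact: measurable_push.
  under eq_integral do rewrite gee0_abs ?push_ge0//.
  by rewrite integral_push.
(* Conservation of mass turns the right-hand side into an integral over the arrival state, so that a
   pointwise comparison suffices. *)
rewrite [leRHS](_ : _ = \int[refS M]_s' push pol q h s'); last first.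
  by rewrite integral_push.
apply: ae_ge0_le_integral => //.
- by apply: measurable_abseB; exact: measurable_push.
- by move=> s' _; exact: push_ge0.
- exact: measurable_push.
have := fin _ f0 mf foo; have := fin _ g0 mg goo.
apply: filterS2 => s' /(_ I) Gf /(_ I) Ff _.
have h1 : push pol q f s' <= push pol q g s' + push pol q h s'.
  rewrite -pushD//; apply: le_push => //; first exact: emeasurable_funD.
  by move=> s; exact: lee_addl_abseB.
have h2 : push pol q g s' <= push pol q f s' + push pol q h s'.
  rewrite -pushD//; apply: le_push => //; first exact: emeasurable_funD.
  by move=> s; exact: lee_addr_abseB.
rewrite -(fineK Ff) -(fineK Gf) in h1 h2 *.
move: h1 h2; case: (push pol q h s') (push_ge0 h0 s') => [x| |//] _.
  rewrite -!EFinD !lee_fin => h1 h2.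
  by rewrite ler_norml lerNl opprB !lerBlDl h1 h2.
by rewrite !leey.
Qed.

End kern.

(** * Contraction under the reset kernel and stationarity of the visitation density *)

Section visitation.

Lemma state_density_stepE q pols t :
  state_density M q pols t.+1 = push (pols t) q (state_density M q pols t).
Proof. by []. Qed.

Lemma state_density_prop q pols t :
  transition_density q -> (forall k, (k < t)%N -> policy_density (pols k)) ->
  [/\ forall s, 0 <= state_density M q pols t s,
      measurable_fun setT (state_density M q pols t)
    & \int[refS M]_s state_density M q pols t s = 1].
Proof.
move=> Hq; have [mi i0 i1] := init_density M.
elim: t => [|t IH] Hpol.
  by split => //=; exact/measurable_EFinP.
have [|d0 md d1] := IH; first by move=> k kt; apply: Hpol; exact: leqW.
have Hp := Hpol t (ltnSn t); split; rewrite state_density_stepE.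
- exact: push_ge0.
- exact: measurable_push.
- by rewrite integral_push.
Qed.

Variable pol : S -> A -> R.
Hypothesis Hpol : policy_density pol.
Let gammaP := disc_bounds M.

Let gamma_gt0 : (0 < gamma)%R. Proof. by case/andP: gammaP. Qed.
Let gamma_ge0 : (0 <= gamma)%R. Proof. exact: ltW. Qed.
Let gamma1_ge0 : (0 <= 1 - gamma)%R.
Proof. by case/andP: gammaP => _ /ltW; rewrite subr_ge0. Qed.

(** The reset part of [reset_trans] depends on neither the state nor the action. Averaging it over
    [pol s] and then over [f], both of mass 1, leaves it unchanged. *)
Lemma push_reset f : (forall s, 0 <= f s) -> measurable_fun setT f ->
  \int[refS M]_s f s = 1 -> forall s',
  push pol (reset_trans M) f s' =
  gamma%:E * push pol (trans M) f s' + ((1 - gamma) * init M s')%:E.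
Proof.
move=> f0 mf f1 s'; have [mi i0 i1] := init_density M.
have Hq := transition_density_trans.
have kE s : kern pol (reset_trans M) s s' =
    gamma%:E * kern pol (trans M) s s' + ((1 - gamma) * init M s')%:E.
  have [mp p0 p1] := Hpol.2 s; rewrite /kern.
  have mpq : measurable_fun setT (fun a => pol s a * trans M s a s')%R.
    apply: measurable_funM => //.
    apply: (measurableT_comp (g := fun a : A => (s, a, s')) Hq.1).
    by measurable_proj; exact: measurable_cst.
  have pq0 a : (0 <= pol s a * trans M s a s')%R.
    by have [_ q0 _] := Hq.2 s a; rewrite mulr_ge0.
  transitivity (\int[refA M]_a (gamma%:E * (pol s a * trans M s a s')%:E +
     ((1 - gamma) * init M s')%:E * (pol s a)%:E)).
    apply: eq_integral => a _; rewrite -!EFinM -EFinD; congr (_%:E).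
    by rewrite /reset_trans mulrDr mulrCA [X in (_ + X)%R]mulrC.
  rewrite ge0_integralD//; last 4 first.
  - by move=> a _; rewrite -EFinM lee_fin mulr_ge0.
  - by apply: emeasurable_funM => //; exact/measurable_EFinP.
  - by move=> a _; rewrite -EFinM lee_fin !mulr_ge0.
  - by apply: emeasurable_funM => //; exact/measurable_EFinP.
  rewrite !ge0_integralZl//; last 5 first.
  - exact/measurable_EFinP.
  - by move=> a _; rewrite lee_fin.
  - by rewrite lee_fin mulr_ge0.
  - exact/measurable_EFinP.
  - by move=> a _; rewrite lee_fin.
  by rewrite p1 mule1.
have mk : measurable_fun setT (fun s => kern pol (trans M) s s').
  apply: (measurableT_comp (g := fun s : S => (s, s'))
    (measurable_kern Hpol Hq)).
  by measurable_proj; exact: measurable_cst.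
have k0 s : 0 <= kern pol (trans M) s s' by exact: kern_ge0.
transitivity (\int[refS M]_s (gamma%:E * (f s * kern pol (trans M) s s') +
     ((1 - gamma) * init M s')%:E * f s)).
  apply: eq_integral => s _; rewrite kE ge0_muleDr//; last 2 first.
  - by rewrite mule_ge0// lee_fin.
  - by rewrite lee_fin mulr_ge0.
  by rewrite muleCA [X in _ + X]muleC.
have mfk : measurable_fun setT (fun s => f s * kern pol (trans M) s s').
  exact: emeasurable_funM.
have fk0 s : 0 <= f s * kern pol (trans M) s s' by exact: mule_ge0.
have c0 : 0 <= ((1 - gamma) * init M s')%:E by rewrite lee_fin mulr_ge0.
rewrite ge0_integralD//; last 4 first.
- by move=> s _; rewrite mule_ge0// lee_fin.
- exact: emeasurable_funM.
- by move=> s _; rewrite mule_ge0.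
- exact: emeasurable_funM.
by rewrite !ge0_integralZl// f1 mule1.
Qed.

(** Both pushes carry the same reset term, which cancels. The rest is [gamma] times a difference of
    pushes by [trans M], and these do not increase the L1 distance. *)
Lemma l1dist_push_reset f g : (forall s, 0 <= f s) -> measurable_fun setT f ->
  \int[refS M]_s f s = 1 ->
  (forall s, 0 <= g s) -> measurable_fun setT g -> \int[refS M]_s g s = 1 ->
  l1dist (refS M) (push pol (reset_trans M) f) (push pol (reset_trans M) g) <=
  gamma%:E * l1dist (refS M) f g.
Proof.
move=> f0 mf f1 g0 mg g1; have Hq := transition_density_trans.
rewrite {1}/l1dist; under eq_integral do rewrite !push_reset// abseB_affine//.
rewrite ge0_integralZl//; last first.
  by apply: measurable_abseB; exact: measurable_push.
by rewrite lee_wpmul2l ?lee_fin//; apply: l1dist_push; rewrite ?f1 ?g1 ?ltry.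
Qed.

Let Hstate t := @state_density_prop _ (fun=> pol) t transition_density_trans
  (fun _ _ => Hpol).

Let vis_ge0 n s : 0 <= (gamma ^+ n)%:E * state_density M (trans M) (fun=> pol) n s.
Proof. by have [d0 _ _] := Hstate n; rewrite mule_ge0// lee_fin exprn_ge0. Qed.

Let measurable_vis n :
  measurable_fun setT
    (fun s => (gamma ^+ n)%:E * state_density M (trans M) (fun=> pol) n s).
Proof. by have [_ md _] := Hstate n; exact: emeasurable_funM. Qed.

Lemma visitation_ge0 s : 0 <= visitation M pol s.
Proof.
by rewrite mule_ge0 ?lee_fin//; apply: nneseries_ge0 => n _ _.
Qed.

Lemma measurable_visitation : measurable_fun setT (visitation M pol).
Proof.
apply: emeasurable_funM => //.
by apply: ge0_emeasurable_sum => [n s _ _|n _]; [exact: vis_ge0|].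
Qed.

(** Every state density in the series has mass 1, so the total is [1 - gamma] times the geometric
    series of [gamma]. *)
Lemma integral_visitation : \int[refS M]_s visitation M pol s = 1.
Proof.
rewrite ge0_integralZl//; last 2 first.
- by apply: ge0_emeasurable_sum => [n s _ _|n _]; [exact: vis_ge0|].
- by move=> s _; apply: nneseries_ge0 => n _ _.
rewrite integral_nneseries//.
under eq_eseriesr => n _.
  have [d0 md d1] := Hstate n.
  rewrite ge0_integralZl ?d1 ?mule1 ?lee_fin ?exprn_ge0//; over.
have /andP[_ g1] := gammaP.
have -> : \sum_(0 <= n <oo) (gamma ^+ n)%:E = ((1 - gamma)^-1)%:E.
  apply/cvg_lim => //.
  rewrite (_ : (fun n => _) = EFin \o series (geometric 1%R gamma)).
    apply: cvg_EFin; first by near=> n.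
    rewrite -[(1 - gamma)^-1%R]mul1r.
    by apply: (@cvg_geometric_series R 1%R gamma); rewrite ger0_norm.
  apply/funext => n /=; rewrite sumEFin; congr (_%:E).
  by apply: eq_bigr => i _; rewrite /= mul1r.
by rewrite -EFinM divff// subr_eq0 eq_sym lt_eqF.
Unshelve. all: by end_near. Qed.

(** Pushing by [trans M] advances each term of the series by one time step, and the factor [gamma]
    adjusts its weight. The result lacks only the term of time 0, which is the reset contribution
    [(1 - gamma) * init M]. *)
Lemma push_visitation :
  push pol (reset_trans M) (visitation M pol) = visitation M pol.
Proof.
apply/funext => s'; rewrite push_reset; [|exact: visitation_ge0
  |exact: measurable_visitation|exact: integral_visitation].
have Hq := transition_density_trans.
rewrite {1}/visitation push_nneseries// [RHS]/visitation.
under eq_eseriesr => n _.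
  have -> : push pol (trans M) (fun s =>
      (gamma ^+ n)%:E * state_density M (trans M) (fun=> pol) n s) s' =
      (gamma ^+ n)%:E * state_density M (trans M) (fun=> pol) n.+1 s'.
    have [d0 md _] := Hstate n.
    rewrite state_density_stepE /push -ge0_integralZl//; last 3 first.
    - apply: emeasurable_funM => //.
      apply: (measurableT_comp (g := fun s : S => (s, s'))
        (measurable_kern Hpol Hq)).
      by measurable_proj; exact: measurable_cst.
    - by move=> s _; rewrite mule_ge0// kern_ge0.
    - by rewrite lee_fin exprn_ge0.
    by apply: eq_integral => s _; rewrite muleA.
  over.
rewrite [in RHS]nneseries_recl//.
rewrite -(nneseries_addn 1%N)// expr0 mul1e.
rewrite [RHS]ge0_muleDr//; last 2 first.
- by have [_ i0 _] := init_density M; rewrite lee_fin.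
- by apply: nneseries_ge0 => n _ _; exact: vis_ge0.
rewrite addeC EFinM muleCA; congr (_ + _ * _).
rewrite -nneseriesZl//; last first.
  move=> n _; rewrite mule_ge0 ?lee_fin ?exprn_ge0//.
  by have [d0 _ _] := Hstate n.+1.
by apply: eq_eseriesr => n _; rewrite muleA -EFinM -exprS addn1.
Qed.

End visitation.
End Transition.

(** * Integration against a measure given by a density *)

Section density_measure.
Local Open Scope ereal_scope.
Context {d : measure_display} {T : measurableType d} {R : realType}.
Variables (mu : {measure set T -> \bar R}) (h : T -> R).

(** Taking [mh] and [h0] as arguments lets the term itself determine its measure structure. *)
Definition density_measure (mh : measurable_fun setT h)
  (h0 : forall x, (0 <= h x)%R) (B : set T) : \bar R := \int[mu]_(x in B) (h x)%:E.

Hypotheses (mh : measurable_fun setT h) (h0 : forall x, (0 <= h x)%R).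

Let dens0 : density_measure mh h0 set0 = 0.
Proof. exact: integral_set0. Qed.

Let dens_ge0 B : 0 <= density_measure mh h0 B.
Proof. by apply: integral_ge0 => x _; rewrite lee_fin. Qed.

Let dens_sigma_additive : semi_sigma_additive (density_measure mh h0).
Proof.
move=> /= F mF tF mUF; rewrite /density_measure; apply: cvg_toP.
  apply: ereal_nondecreasing_is_cvgn => m n mn.
  by apply: lee_sum_nneg_natr => // k _ _; exact: dens_ge0.
rewrite ge0_integral_bigcup//=.
- by apply: measurable_funTS; exact/measurable_EFinP.
- by move=> x _; rewrite lee_fin.
Qed.

HB.instance Definition _ := isMeasure.Build _ _ _ (density_measure mh h0)
  dens0 dens_ge0 dens_sigma_additive.

Import HBNNSimple.

Let integral_dens_nnsfun (f : {nnsfun T >-> R}) :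
  \int[density_measure mh h0]_x (f x)%:E = \int[mu]_x ((h x)%:E * (f x)%:E).
Proof.
under [LHS]eq_integral do rewrite fimfunE -fsumEFin//.
rewrite [LHS]ge0_integral_fsum//; last 2 first.
- by move=> r; exact/measurable_EFinP/measurableT_comp.
- by move=> n x _; rewrite EFinM nnfun_muleindic_ge0.
under [RHS]eq_integral.
  move=> x xD; rewrite fimfunE -fsumEFin// ge0_mule_fsumr; last first.
    by move=> r; rewrite EFinM nnfun_muleindic_ge0.
  over.
rewrite [RHS]ge0_integral_fsum//; last 2 first.
- move=> r; apply: emeasurable_funM; first exact/measurable_EFinP.
  by apply/measurable_EFinP; exact/measurableT_comp.
- move=> r x _; apply: mule_ge0; first by rewrite lee_fin.
  by rewrite EFinM nnfun_muleindic_ge0.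
apply: eq_fsbigr => r _; rewrite integralZl_indic_nnsfun//.
rewrite integral_indic//= setIT /density_measure.
(* The sum runs over real values r; a negative one has empty preimage under the nonnegative [f], and
   both sides are 0. *)
have [r0|r0] := leP 0%R r; last first.
  rewrite preimage_nnfun0// integral_set0 mule0 integral0_eq// => x _.
  by rewrite indic0 /= mulr0 mule0.
rewrite integral_mkcond -ge0_integralZl//; last 2 first.
- apply/(measurable_restrictT _ _).1 => //.
  by apply: measurable_funTS; exact/measurable_EFinP.
- by move=> x _; apply: erestrict_ge0 => y _; rewrite lee_fin.
apply: eq_integral => x _; rewrite epatch_indic EFinM.
by rewrite /= muleCA.
Qed.

(** The identity for simple functions passes to increasing limits by monotone convergence on both
    sides; [h] is finite, so multiplication by it commutes with the limit. *)
Lemma integral_density_measure (f : T -> \bar R) :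
  measurable_fun setT f -> (forall x, 0 <= f x) ->
  \int[density_measure mh h0]_x f x = \int[mu]_x ((h x)%:E * f x).
Proof.
move=> mf f0; pose f_ := nnsfun_approx measurableT mf.
have f_E x : f x = limn (fun n => (f_ n x)%:E).
  by apply/esym/cvg_lim => //; exact: cvg_nnsfun_approx.
have cf x : cvgn (fun n => (f_ n x)%:E).
  by apply: cvgP; exact: cvg_nnsfun_approx.
have ndf x : {homo (fun n => (f_ n x)%:E) : m n / (m <= n)%N >-> m <= n}.
  by move=> m n mn; rewrite lee_fin; exact/lefP/nd_nnsfun_approx.
under [LHS]eq_integral do rewrite f_E.
rewrite monotone_convergence//=; last 2 first.
- by move=> n; exact/measurable_EFinP.
- by move=> n x _; rewrite lee_fin.
under [RHS]eq_integral do rewrite f_E -limeMl//.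
rewrite monotone_convergence//=; last 3 first.
- by move=> n; apply: emeasurable_funM; exact/measurable_EFinP.
- by move=> n x _; rewrite mule_ge0// lee_fin.
- by move=> x _ m n mn; rewrite lee_wpmul2l ?lee_fin//; exact: ndf.
by apply: congr_lim; apply/funext => n; exact: integral_dens_nnsfun.
Qed.

End density_measure.

(* The library's own sigma-finite instance on [\x] is shadowed by the one for
   subprobabilities. *)
Section product_reference.
Local Open Scope ereal_scope.
Context {R : realType} {d1 d2 : measure_display}.
Context {T1 : measurableType d1} {T2 : measurableType d2}.
Variables (m1 : {sigma_finite_measure set T1 -> \bar R}).
Variables (m2 : {sigma_finite_measure set T2 -> \bar R}).

Definition prod_ref : set (T1 * T2) -> \bar R := m1 \x m2.

HB.instance Definition _ := Measure.on prod_ref.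

(** The exhaustions of the factors are taken increasing, so that a pair of points lies in a product
    of sets with one common index, the larger of the two. *)
Let prod_ref_sigma_finite : sigma_finite setT prod_ref.
Proof.
have /sigma_finiteP[F [F_cover F_nd F_fin]] := sigma_finiteT m1.
have /sigma_finiteP[G [G_cover G_nd G_fin]] := sigma_finiteT m2.
exists (fun n => F n `*` G n) => [|n].
  apply/seteqP; split => // -[u v] _.
  have [i _ Fu] : (\bigcup_i F i) u by rewrite -F_cover.
  have [j _ Gv] : (\bigcup_i G i) v by rewrite -G_cover.
  exists (maxn i j) => //; split => /=.
    by have /subsetPset := F_nd _ _ (leq_maxl i j); exact.
  by have /subsetPset := G_nd _ _ (leq_maxr i j); exact.
have [[mF Foo] [mG Goo]] := (F_fin n, G_fin n); split; first exact: measurableX.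
by rewrite /prod_ref product_measure1E// lte_mul_pinfty// ge0_fin_numE.
Qed.

HB.instance Definition _ :=
  Measure_isSigmaFinite.Build _ _ _ prod_ref prod_ref_sigma_finite.

End product_reference.

(** * From sampling probabilities of boxes to expectations of functions *)

Section conditional_law.
Local Open Scope ereal_scope.
Context {R : realType} {dT dX dA dS : measure_display}.
Context {T : measurableType dT} {X : measurableType dX}.
Context {A : measurableType dA} {S : measurableType dS}.

Definition box3 : set (set (X * (A * S))) :=
  [set D | exists E B C, [/\ measurable E, measurable B, measurable C &
    D = E `*` (B `*` C)]].

(** For the inclusion of the product sigma-algebra, the identity is measurable from the
    box-generated one because the preimage of a measurable set under each coordinate is itself a
    box. *)
Lemma measurable_box3 : measurable = <<s box3 >>.
Proof.
apply/seteqP; split=> [D mD|]; last first.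
  apply: smallest_sub; first exact: sigma_algebra_measurable.
  by move=> _ [E [B [C [mE mB mC ->]]]]; do 2 apply: measurableX => //.
pose U := g_sigma_algebraType box3.
have box (E : set X) (B : set A) (C : set S) : measurable E -> measurable B ->
    measurable C -> measurable (E `*` (B `*` C) : set U).
  by move=> mE mB mC; apply: sub_sigma_algebra; exists E, B, C.
have mid : measurable_fun (setT : set U) (id : U -> X * (A * S)).
  have -> : (id : U -> X * (A * S)) = fun u => (u.1, (u.2.1, u.2.2)).
    by apply/funext => -[? []].
  apply: measurable_fun_pair; last apply: measurable_fun_pair.
  - move=> _ E mE; rewrite setTI (_ : _ @^-1` _ = E `*` (setT `*` setT)).
      exact: box.
    by apply/seteqP; split=> -[? [? ?]] //= [].
  - move=> _ E mE; rewrite setTI (_ : _ @^-1` _ = setT `*` (E `*` setT)).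
      exact: box.
    by apply/seteqP; split=> -[? [? ?]] //= [_ []].
  - move=> _ E mE; rewrite setTI (_ : _ @^-1` _ = setT `*` (setT `*` E)).
      exact: box.
    by apply/seteqP; split=> -[? [? ?]] //= [_ []].
by have := mid measurableT D mD; rewrite setTI.
Qed.

Variables (Pr : probability T R) (x : T -> X) (a : T -> A) (y : T -> S).
Variables (nA : {sigma_finite_measure set A -> \bar R}).
Variables (nS : {sigma_finite_measure set S -> \bar R}).
Hypotheses (mx : measurable_fun setT x) (ma : measurable_fun setT a).
Hypothesis my : measurable_fun setT y.

Let x_RV : {mfun T >-> X} := HB.pack x (isMeasurableFun.Build _ _ _ _ _ mx).
Local Notation PX := (distribution Pr x_RV).
Local Notation nAS := (prod_ref nA nS).

(** Tonelli twice, then a change of variables from the law of [x] back to [Pr]. *)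
Let integral_PX (k : X * (A * S) -> \bar R) : measurable_fun setT k ->
  (forall z, 0 <= k z) ->
  \int[PX \x nAS]_z k z = \int[Pr]_w \int[nA]_u \int[nS]_v k (x w, (u, v)).
Proof.
move=> mk k0; rewrite fubini_tonelli1// ge0_integral_distribution//; last 2 first.
- exact: measurable_fun_fubini_tonelli_F.
- by move=> z; apply: integral_ge0.
apply: eq_integral => w _; rewrite /= /fubini_F fubini_tonelli1//.
by apply: (measurableT_comp mk); measurable_proj; exact: measurable_cst.
Qed.

(** The hypothesis on boxes says that the joint law of [x], [a], [y] and the measure with density
    [h] over the law of [x] times the reference measures agree on a generating family closed under
    intersection. They are therefore equal and give every nonnegative [g] the same integral. *)
Lemma conditional_law (h : X * (A * S) -> R) : measurable_fun setT h ->
  (forall z, 0 <= h z)%R ->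
  (forall (E : set X) (B : set A) (C : set S),
    measurable E -> measurable B -> measurable C ->
    Pr (x @^-1` E `&` a @^-1` B `&` y @^-1` C) =
    \int[Pr]_(w in x @^-1` E) \int[nA]_(u in B) \int[nS]_(v in C)
      (h (x w, (u, v)))%:E) ->
  forall g : X * (A * S) -> \bar R, measurable_fun setT g ->
  (forall z, 0 <= g z) ->
  \int[Pr]_w g (x w, (a w, y w)) =
  \int[Pr]_w \int[nA]_u \int[nS]_v ((h (x w, (u, v)))%:E * g (x w, (u, v))).
Proof.
move=> mh h0 law g mg g0.
have mZ : measurable_fun setT (fun w => (x w, (a w, y w))).
  by measurable_proj.
pose Z : {mfun T >-> (X * (A * S))%type} :=
  HB.pack (fun w => (x w, (a w, y w))) (isMeasurableFun.Build _ _ _ _ _ mZ).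
transitivity (\int[distribution Pr Z]_z g z).
  by rewrite ge0_integral_distribution.
rewrite -(integral_PX (k := fun z => (h z)%:E * g z)); last 2 first.
- by apply: emeasurable_funM => //; exact/measurable_EFinP.
- by move=> z; rewrite mule_ge0// lee_fin.
rewrite -(integral_density_measure (PX \x nAS) mh h0)//.
apply: eq_measure_integral => /= D mD _.
(* The whole space is itself a box of finite mass, so the constant sequence [setT] serves as the
   exhaustion. *)
apply: (@measure_unique _ _ _ box3 (fun=> setT) measurable_box3) => //.
- move=> _ _ [E [B [C [mE mB mC ->]]]] [E' [B' [C' [mE' mB' mC' ->]]]].
  exists (E `&` E'), (B `&` B'), (C `&` C'); split; try exact: measurableI.
  by rewrite !setXI.
- by move=> _; exists setT, setT, setT; split => //; rewrite !setXTT.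
- by rewrite bigcup_const.
- move=> _ [E [B [C [mE mB mC ->]]]].
  have mD3 : measurable (E `*` (B `*` C)) by do 2 apply: measurableX => //.
  rewrite [LHS](_ : _ = Pr (Z @^-1` (E `*` (B `*` C))))//.
  rewrite [RHS](_ : _ = \int[PX \x nAS]_(z in E `*` (B `*` C)) (h z)%:E)//.
  rewrite [X in Pr X](_ : _ = x @^-1` E `&` a @^-1` B `&` y @^-1` C); last first.
    by apply/seteqP; split=> w /=; [case=> ? []|case=> -[]].
  rewrite law// integral_mkcond [RHS]integral_mkcond integral_PX; last 2 first.
  + apply/(measurable_restrictT _ _).1 => //.
    by apply: measurable_funTS; exact/measurable_EFinP.
  + by move=> z; apply: erestrict_ge0 => ? _; rewrite lee_fin.
  apply: eq_integral => w _; rewrite patchE.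
  have [|] := boolP (w \in x @^-1` E); rewrite ?notin_setE ?inE/= => Ew.
    rewrite integral_mkcond; apply: eq_integral => u _; rewrite patchE.
    have [|] := boolP (u \in B); rewrite ?notin_setE ?inE/= => Bu.
      rewrite integral_mkcond; apply: eq_integral => v _; rewrite !patchE.
      have [|] := boolP (v \in C); rewrite ?notin_setE ?inE/= => Cv.
        by rewrite mem_set.
      by rewrite memNset// => -[_ []].
    rewrite integral0_eq// => v _; rewrite patchE memNset// => -[_ []] //.
  rewrite integral0_eq// => u _; rewrite integral0_eq// => v _.
  by rewrite patchE memNset// => -[].
- by move=> _; rewrite ltey_eq fin_num_measure.
Qed.

End conditional_law.

(** * Comparison of integrals and of moments *)

Section integral_bounds.
Local Open Scope ereal_scope.
Context {d : measure_display} {T : measurableType d} {R : realType}.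
Variable mu : {measure set T -> \bar R}.

(** The integral of a nonnegative function is a supremum over the simple functions below it, and
    this set grows with the function. It serves for integrands whose measurability is not at
    hand. *)
Lemma ge0_le_integral_any (f g : T -> \bar R) : (forall x, 0 <= f x) ->
  (forall x, f x <= g x) -> \int[mu]_x f x <= \int[mu]_x g x.
Proof.
move=> f0 fg; have g0 x : 0 <= g x by exact: le_trans (fg x).
rewrite !ge0_integralTE//; apply: ub_ereal_sup => _ [h hf <-].
by apply: ereal_sup_ubound; exists h => // x; exact: le_trans (fg x).
Qed.

End integral_bounds.

(* For every c > 0, |X| <= (X^2 / c + c) / 2; take c = C + e. *)
Lemma first_moment_le {d} {T : measurableType d} {R : realType}
    (Pr : probability T R) (X : T -> R) (C : R) :
  measurable_fun setT X -> 0 <= C ->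
  (\int[Pr]_w (X w ^+ 2)%:E <= (C ^+ 2)%:E ->
   \int[Pr]_w `|X w|%:E <= C%:E)%E.
Proof.
move=> mX C0 X2.
(* The slack e keeps the divisor [C + e] positive when [C] is 0. *)
suff le_eps (e : R) : 0 < e -> (\int[Pr]_w `|X w|%:E <= C%:E + e%:E)%E.
  exact/lee_addgt0Pr.
move=> e0.
have c0 : 0 < C + e by rewrite ltr_wpDl.
pose k := (2 * (C + e))^-1; have k0 : 0 <= k.
  by rewrite invr_ge0 mulr_ge0 ?ltW.
have bound w : `|X w| <= k * X w ^+ 2 + (C + e) / 2.
  rewrite -[X w ^+ 2]real_normK ?num_real//.
  rewrite -subr_ge0 (_ : _ - _ = k * (`|X w| - (C + e)) ^+ 2).
    by rewrite mulr_ge0// sqr_ge0.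
  by rewrite /k; field; rewrite gt_eqF.
have le1 : (\int[Pr]_w `|X w|%:E <=
    \int[Pr]_w (k%:E * (X w ^+ 2)%:E + ((C + e) / 2)%:E))%E.
  by apply: ge0_le_integral_any => w; rewrite lee_fin.
apply: (le_trans le1).
have mX2 : measurable_fun setT (fun w => (X w ^+ 2)%:E).
  by apply/measurable_EFinP; exact: measurable_funX.
rewrite ge0_integralD//; last 3 first.
- by move=> w _; rewrite -EFinM lee_fin mulr_ge0// sqr_ge0.
- exact: emeasurable_funM.
- by move=> w _; rewrite lee_fin divr_ge0// ltW.
rewrite ge0_integralZl//; last by move=> w _; rewrite lee_fin sqr_ge0.
rewrite integral_cst//= probability_setT mule1.
apply: (le_trans (leeD2r _ (lee_wpmul2l _ X2))); first by rewrite lee_fin.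
rewrite -EFinM -!EFinD lee_fin.
have : k * C ^+ 2 <= (C + e) / 2; last by lra.
apply: (@le_trans _ _ (k * (C + e) ^+ 2)).
  by rewrite ler_wpM2l// ler_sqr ?nnegrE ?(ltW c0)// lerDl ltW.
by rewrite le_eqVlt; apply/orP; left; apply/eqP; rewrite /k; field; rewrite gt_eqF.
Qed.

(** * Euclidean norm, projection and Borel coordinates *)

Section euclidean.
Context {R : realType} {n : nat}.
Implicit Type x : 'cV[R]_n.

Lemma enorm_ge0 x : 0 <= enorm x.
Proof. exact: sqrtr_ge0. Qed.

Lemma enormZ (c : R) x : enorm (c *: x) = `|c| * enorm x.
Proof.
rewrite /enorm -sqrtr_sqr -sqrtrM ?sqr_ge0// mulr_sumr.
by congr Num.sqrt; apply: eq_bigr => i _; rewrite mxE exprMn.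
Qed.

Lemma enormN x : enorm (- x) = enorm x.
Proof. by rewrite -scaleN1r enormZ normrN1 mul1r. Qed.

Lemma enorm_proj_ball (c : R) x : 0 <= c -> enorm (proj_ball c x) <= c.
Proof.
move=> c0; rewrite /proj_ball; case: ifPn => //; rewrite -ltNge => cx.
have x0 : 0 < enorm x by exact: le_lt_trans cx.
by rewrite enormZ ger0_norm ?divr_ge0 ?enorm_ge0// divfK// gt_eqF.
Qed.

Lemma measurable_coord (i : 'I_n) (j : 'I_1) :
  measurable_fun setT (fun v : borel 'cV[R]_n => v i j).
Proof.
apply: (measurability _ (RGenOpens.measurableE R)) => _ [_ [a [b ->]] <-].
rewrite setTI; apply: sub_sigma_algebra.
apply: open_comp => [v _|]; first exact: coord_continuous.
exact: interval_open.
Qed.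

End euclidean.

(** * The distance recursion along a fixed sequence of parameters *)

Section policy.
Context {R : realType} {dS dA : measure_display}.
Context {S : measurableType dS} {A : measurableType dA} (M : mdp R S A).
Context {p : nat} (Theta : set 'cV[R]_p) (pi : 'cV[R]_p -> S -> A -> R).
Hypothesis Hpi : policy_class M Theta pi.

Lemma policy_density_of_class th : Theta th -> policy_density M (pi th).
Proof.
move=> Hth; split; last by move=> s; have [] := Hpi.2 _ Hth s.
apply: (measurableT_comp
  (f := fun x : borel 'cV[R]_p * (S * A) => pi x.1 x.2.1 x.2.2)
  (g := fun x : S * A => (th, (x.1, x.2))) Hpi.1).
by measurable_proj; exact: measurable_cst.
Qed.

(** Induction on [t], with the triangle inequality through the visitation density of [th t]. The
    sequence is deterministic, so the bound applies to each run separately. *)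
Lemma l1dist_sampling_visitation (Lnu : R) (th : nat -> 'cV[R]_p) (t : nat) :
  visitation_lipschitz M Theta pi Lnu -> (forall k, Theta (th k)) ->
  (l1dist (refS M) (sampling_density M pi th t) (visitation M (pi (th t))) <=
   (\sum_(k < t) disc M ^+ (t - 1 - k) * (Lnu * enorm (th k - th k.+1)))%:E +
   (disc M ^+ t)%:E *
     l1dist (refS M) (EFin \o init M) (visitation M (pi (th 0%N))))%E.
Proof.
move=> [Lnu0 HLnu] Hth; have g0 := ltW (andP (disc_bounds M)).1.
have Hp k : policy_density M (pi (th k)) by exact: policy_density_of_class.
have Hreset := transition_density_reset M.
elim: t => [|t IH]; first by rewrite big_ord0 add0e expr0 mul1e.
have [d0 md d1] := state_density_prop Hreset (t := t) (fun k _ => Hp k).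
have [d0' md' d1'] := state_density_prop Hreset (t := t.+1) (fun k _ => Hp k).
have vis k := (visitation_ge0 (Hp k), measurable_visitation (Hp k),
  integral_visitation (Hp k)).
apply: le_trans (l1dist_triangle (g := visitation M (pi (th t))) _ _ _ _) _ => //;
  [exact: (vis t).1.2|exact: (vis t.+1).1.2|].
have contr : (l1dist (refS M) (sampling_density M pi th t.+1)
    (visitation M (pi (th t))) <=
    (disc M)%:E * l1dist (refS M) (sampling_density M pi th t)
      (visitation M (pi (th t))))%E.
  rewrite -[in leLHS](push_visitation (Hp t)) /sampling_density.
  rewrite state_density_stepE.
  by apply: l1dist_push_reset => //; [exact: (vis t).1.1|exact: (vis t).1.2
    |exact: (vis t).2].
apply: le_trans (leeD (le_trans contr (lee_wpmul2l _ IH)) (HLnu _ _ _ _)) _ => //.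
rewrite muleDr//.
rewrite muleA -!EFinM -exprS addeAC -EFinD leeD2r// lee_fin.
(* The new summand has exponent 0. The factor [disc M] raises each older exponent by one, and
   truncated subtraction is exact there because k < t. *)
rewrite big_ord_recr/= subSS subn0 subnn expr0 mul1r lerD2r mulr_sumr.
apply: ler_sum => k _; rewrite [leLHS]mulrA. rewrite -exprS.
by rewrite subnAC subn1 prednK ?subn_gt0.
Qed.

End policy.

(** * Moments of the temporal-difference error along a run *)

Section run.
Context {R : realType} {dS dA dT : measure_display}.
Context {S : measurableType dS} {A : measurableType dA} (M : mdp R S A).
Context {p q d : nat} {Theta : set 'cV[R]_p} {Phi : set 'cV[R]_q}.
Context (pi : 'cV[R]_p -> S -> A -> R).
Context (r : 'cV[R]_q -> S -> A -> R) (alpha : 'cV[R]_q -> R).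
Context (feat : S -> 'cV[R]_d).
Context {L Sm Comega Cdelta : R} {eta_theta eta_omega : nat -> R}.
Context {theta0 : 'cV[R]_p} {omega0 : 'cV[R]_d} {phi0 : 'cV[R]_q}.
Context {T : measurableType dT} {Pr : probability T R} {F : nat -> set (set T)}.
Context (s : nat -> T -> S) (a : nat -> T -> A) (s' : nat -> T -> S).
Context (theta : nat -> T -> 'cV[R]_p) (omega : nat -> T -> 'cV[R]_d).
Context (phi : nat -> T -> 'cV[R]_q).
Hypothesis Hpi : policy_class M Theta pi.
Hypothesis Hr : reward_class Phi r alpha.
Hypothesis Hfeat : feature_map feat.
Hypothesis HCdelta : td_error_bound M Theta Phi pi r alpha feat Comega Cdelta.
Hypothesis Homega0 : enorm omega0 <= Comega.
Hypothesis Hrun : actor_critic M Theta Phi pi r alpha feat Comega eta_theta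
  eta_omega theta0 omega0 phi0 Pr F s a s' theta omega phi.

Local Notation info :=
  (borel 'cV[R]_p * (borel 'cV[R]_d * (borel 'cV[R]_q * S)))%type.

(** This is what the error at time t depends on besides the fresh samples [a t] and [s' t]; it plays
    the conditioning variable in [conditional_law]. *)
Let x t w : info := (theta t w, (omega t w, (phi t w, s t w))).

Let td (z : info * (A * S)) : R :=
  td_error M pi r alpha feat z.1.2.2.1 z.1.1 z.1.2.1 z.1.2.2.2 z.2.1 z.2.2.

Definition run_td_error t w : R :=
  td_error M pi r alpha feat (phi t w) (theta t w) (omega t w) (s t w) (a t w)
    (s' t w).

Lemma enorm_omega_le t w : enorm (omega t w) <= Comega.
Proof.
case: t => [|t]; first by have [_ -> _] := ac_params_init Hrun w.
rewrite (ac_omega_update Hrun); apply: enorm_proj_ball.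
exact: le_trans (enorm_ge0 _) Homega0.
Qed.

Let measurable_td : measurable_fun setT td.
Proof.
have [mr malpha _] := Hr.
have mpi : measurable_fun setT
    (fun z : info * (A * S) => pi z.1.1 z.1.2.2.2 z.2.1).
  apply: (measurableT_comp
    (f := fun u : borel 'cV[R]_p * (S * A) => pi u.1 u.2.1 u.2.2)
    (g := fun z : info * (A * S) => (z.1.1, (z.1.2.2.2, z.2.1))) Hpi.1).
  by measurable_proj.
have mrew : measurable_fun setT
    (fun z : info * (A * S) => r z.1.2.2.1 z.1.2.2.2 z.2.1).
  apply: (measurableT_comp
    (f := fun u : borel 'cV[R]_q * (S * A) => r u.1 u.2.1 u.2.2)
    (g := fun z : info * (A * S) => (z.1.2.2.1, (z.1.2.2.2, z.2.1))) mr).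
  by measurable_proj.
have malp : measurable_fun setT (fun z : info * (A * S) => alpha z.1.2.2.1).
  by apply: (measurableT_comp malpha); measurable_proj.
apply: measurable_funD.
  apply: measurable_funB => //; apply: measurable_funM => //.
  exact: (measurableT_comp (@measurable_ln R) mpi).
have mfeat i (g : info * (A * S) -> S) : measurable_fun setT g ->
    measurable_fun setT (fun z => feat (g z) i ord0).
  move=> mg; apply: (measurableT_comp (measurable_coord i ord0)).
  exact: (measurableT_comp Hfeat.1 mg).
have -> : (fun z : info * (A * S) =>
    ((disc M *: feat z.2.2 - feat z.1.2.2.2)^T *m z.1.2.1) ord0 ord0) =
  (fun z => \sum_i (disc M * feat z.2.2 i ord0 - feat z.1.2.2.2 i ord0) *
     z.1.2.1 i ord0).
  by apply/funext => z; rewrite mxE; apply: eq_bigr => i _; rewrite !mxE.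
apply: measurable_sum => i; apply: measurable_funM.
  apply: measurable_funB; first apply: measurable_funM => //.
    by apply: mfeat; measurable_proj.
  by apply: mfeat; measurable_proj.
by apply: (measurableT_comp (measurable_coord i ord0)); measurable_proj.
Qed.

Let sub_measurable t : F t `<=` measurable.
Proof. by have [] := ac_filtration Hrun t. Qed.

(** Each component is measurable with respect to [F t], hence so is the tuple. Events about [x t]
    thus qualify as the conditioning events of [ac_sampling]. *)
Let preimage_info t (E : set info) : measurable E -> F t (x t @^-1` E).
Proof.
move=> mE; have [sF _ _] := ac_filtration Hrun t.
have [mth mom mph] := ac_param_adapted Hrun t.
have FE (B : set T) : F t B -> measurable (B : set (g_sigma_algebraType (F t))).
  by move=> FB; exact: sub_sigma_algebra.
have mx : measurable_fun setT (x t : g_sigma_algebraType (F t) -> info).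
  apply: measurable_fun_pair; last apply: measurable_fun_pair;
    last apply: measurable_fun_pair.
  - by move=> _ B mB; rewrite setTI; apply: FE; exact: mth.
  - by move=> _ B mB; rewrite setTI; apply: FE; exact: mom.
  - by move=> _ B mB; rewrite setTI; apply: FE; exact: mph.
  - by move=> _ B mB; rewrite setTI; apply: FE; exact: (ac_state_adapted Hrun).
rewrite -(sigma_algebra_id sF).
by have := mx measurableT E mE; rewrite setTI.
Qed.

Let measurable_x t : measurable_fun setT (x t).
Proof.
move=> _ E mE; rewrite setTI; apply: (@sub_measurable t); exact: preimage_info.
Qed.

Let measurable_a t : measurable_fun setT (a t).
Proof.
move=> _ B mB; rewrite setTI; apply: (@sub_measurable t.+1).
exact: (ac_action_adapted Hrun).
Qed.

Let measurable_s' t : measurable_fun setT (s' t).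
Proof.
move=> _ B mB; rewrite setTI; apply: (@sub_measurable t.+1).
exact: (ac_next_adapted Hrun).
Qed.

Lemma measurable_run_td_error t : measurable_fun setT (run_td_error t).
Proof.
apply: (measurableT_comp (g := fun w => (x t w, (a t w, s' t w))) measurable_td).
apply: measurable_fun_pair; first exact: measurable_x.
by apply: measurable_fun_pair; [exact: measurable_a|exact: measurable_s'].
Qed.

(* The absolute value keeps the density nonnegative off Theta. *)
Let h (z : info * (A * S)) : R :=
  `|pi z.1.1 z.1.2.2.2 z.2.1| * trans M z.1.2.2.2 z.2.1 z.2.2.

Let trans_ge0 u v y : 0 <= trans M u v y.
Proof. by have [_ t0 _] := trans_density M u v. Qed.

Let measurable_h : measurable_fun setT h.
Proof.
apply: measurable_funM.
  apply: measurableT_comp => //.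
  apply: (measurableT_comp
    (f := fun u : borel 'cV[R]_p * (S * A) => pi u.1 u.2.1 u.2.2)
    (g := fun z : info * (A * S) => (z.1.1, (z.1.2.2.2, z.2.1))) Hpi.1).
  by measurable_proj.
apply: (measurableT_comp
    (f := fun u : S * A * S => trans M u.1.1 u.1.2 u.2)
    (g := fun z : info * (A * S) => (z.1.2.2.2, z.2.1, z.2.2))
    (trans_measurable M)).
by measurable_proj.
Qed.

Let hE t w u v :
  h (x t w, (u, v)) = pi (theta t w) (s t w) u * trans M (s t w) u v.
Proof.
rewrite /h/= ger0_norm//; apply: ltW.
by have [/(_ u)] := Hpi.2 _ (ac_params_in Hrun t w).1 (s t w).
Qed.

Let pi_ge0 t w u : 0 <= pi (theta t w) (s t w) u.
Proof.
by have [/(_ u)/ltW] := Hpi.2 _ (ac_params_in Hrun t w).1 (s t w).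
Qed.

(** The state at time t+1 is marginalized out: with [C'] the whole space, its reset density
    contributes the factor 1. *)
Let law t (E : set info) (B : set A) (C : set S) :
  measurable E -> measurable B -> measurable C ->
  (Pr (x t @^-1` E `&` a t @^-1` B `&` s' t @^-1` C) =
   \int[Pr]_(w in x t @^-1` E) \int[refA M]_(u in B) \int[refS M]_(v in C)
     (h (x t w, (u, v)))%:E)%E.
Proof.
move=> mE mB mC.
have := ac_sampling Hrun (preimage_info t mE) mB mC measurableT.
rewrite preimage_setT setIT => ->.
apply: eq_integral => w _; apply: eq_integral => u _.
have [_ reset_dens] := transition_density_reset M.
have [mt _ _] := trans_density M (s t w) u.
have [_ _ next1] := reset_dens (s t w) u.
rewrite [X in (_ * X)%E]next1 mule1.
under [RHS]eq_integral do rewrite hE EFinM.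
rewrite ge0_integralZl// ?lee_fin ?pi_ge0//.
- by apply: measurable_funTS; exact/measurable_EFinP.
- by move=> v _; rewrite lee_fin.
Qed.

(** At the Dirac mass in [u] the averaged bound becomes pointwise. The bulk of the proof is the
    measurability in the state that evaluating the Dirac integral requires. *)
Lemma step_mean_td_error_le th ph (om : 'cV[R]_d) u :
  Theta th -> Phi ph -> enorm om <= Comega ->
  (step_mean M (pi th) u (fun v y => (td_error M pi r alpha feat ph th om u v y ^+ 2)%R)
   <= (Cdelta ^+ 2)%:E)%E.
Proof.
move=> Hth Hph Hom.
have := HCdelta.2 (\d_u)%R th ph om Hth Hph Hom.
rewrite integral_dirac//; first by rewrite diracT mul1e.
have [mpi pi0] := policy_density_of_class Hpi Hth.
apply: (measurable_fun_fubini_tonelli_F (m2 := refA M) (fun z : S * A =>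
   ((pi th z.1 z.2)%:E * \int[refS M]_y (trans M z.1 z.2 y *
      td_error M pi r alpha feat ph th om z.1 z.2 y ^+ 2)%:E)%E)); last first.
  move=> z; have [_ pi00 _] := pi0 z.1.
  rewrite mule_ge0 ?lee_fin//; apply: integral_ge0 => y _.
  by rewrite lee_fin mulr_ge0// sqr_ge0.
apply: emeasurable_funM; first exact/measurable_EFinP.
apply: (measurable_fun_fubini_tonelli_F (m2 := refS M) (fun z : S * A * S =>
   (trans M z.1.1 z.1.2 z.2 *
      td_error M pi r alpha feat ph th om z.1.1 z.1.2 z.2 ^+ 2)%:E)); last first.
  by move=> z; rewrite lee_fin mulr_ge0// sqr_ge0.
apply/measurable_EFinP; apply: measurable_funM; first exact: trans_measurable.
apply: measurable_funX.
apply: (measurableT_comp (g := fun z : S * A * S =>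
  ((th, (om, (ph, z.1.1))) : info, (z.1.2, z.2))) measurable_td).
by measurable_proj; exact: measurable_cst.
Qed.

Lemma second_moment_run_td_error t :
  (\int[Pr]_w (run_td_error t w ^+ 2)%:E <= (Cdelta ^+ 2)%:E)%E.
Proof.
have mtd2 : measurable_fun setT (fun z => (td z ^+ 2)%:E).
  by apply/measurable_EFinP; exact: measurable_funX.
have td20 z : (0 <= (td z ^+ 2)%:E)%E by rewrite lee_fin sqr_ge0.
have h0 z : 0 <= h z by rewrite mulr_ge0.
rewrite (conditional_law (measurable_x t) (@measurable_a t) (@measurable_s' t)
  measurable_h h0 (@law t) mtd2 td20).
rewrite -[leRHS](_ : \int[Pr]_w (cst (Cdelta ^+ 2)%:E w) = _)%E; last first.
  by rewrite integral_cst//= probability_setT mule1.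
apply: ge0_le_integral_any => w.
  apply: integral_ge0 => u _; apply: integral_ge0 => v _.
  by rewrite mule_ge0// lee_fin.
have [Hth Hph] := ac_params_in Hrun t w.
apply: le_trans (step_mean_td_error_le (s t w) Hth Hph (enorm_omega_le t w)).
(* The two sides are equal: [h] splits into policy and transition densities, and the policy factor
   leaves the inner integral. *)
rewrite le_eqVlt; apply/orP; left; apply/eqP; apply: eq_integral => u _.
under eq_integral do rewrite hE -EFinM -mulrA EFinM.
rewrite ge0_integralZl// ?lee_fin ?pi_ge0//.
- apply/measurable_EFinP; apply: measurable_funM.
    by have [] := trans_density M (s t w) u.
  apply: measurable_funX.
  apply: (measurableT_comp (g := fun v : S => (x t w, (u, v))) measurable_td).
  by measurable_proj; exact: measurable_cst.
- by move=> v _; rewrite lee_fin mulr_ge0// sqr_ge0.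
Qed.

Lemma first_moment_run_td_error t : (\int[Pr]_w `|run_td_error t w|%:E <= Cdelta%:E)%E.
Proof.
apply: first_moment_le (second_moment_run_td_error t).
  exact: measurable_run_td_error.
exact: HCdelta.1.
Qed.

Lemma enorm_theta_step t w : 0 <= eta_theta t -> policy_lipschitz Theta pi L Sm ->
  enorm (theta t w - theta t.+1 w) <= L * eta_theta t * `|run_td_error t w|.
Proof.
move=> eta0 Hlip; have [_ Hgrad _] :=
  Hlip (theta t w) (s t w) (a t w) (ac_params_in Hrun t w).1.
rewrite (ac_theta_update Hrun) opprD addrA subrr add0r enormN enormZ.
rewrite normrM (ger0_norm eta0) mulrC -/(run_td_error t w) -mulrA.
by rewrite ler_wpM2r// mulr_ge0.
Qed.

End run.

(** * Expectation of the pathwise bound *)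

Theorem proposition4p8
  (R : realType) (dS dA dT : measure_display)
  (S : measurableType dS) (A : measurableType dA) (M : mdp R S A)
  (p q d : nat) (Theta : set 'cV[R]_p) (Phi : set 'cV[R]_q)
  (pi : 'cV[R]_p -> S -> A -> R)
  (r : 'cV[R]_q -> S -> A -> R) (alpha : 'cV[R]_q -> R)
  (feat : S -> 'cV[R]_d)
  (L Sm C D Comega Lnu Cdelta : R)
  (eta_theta eta_omega : nat -> R)
  (theta0 : 'cV[R]_p) (omega0 : 'cV[R]_d) (phi0 : 'cV[R]_q)
  (T : measurableType dT) (Pr : probability T R) (F : nat -> set (set T))
  (s : nat -> T -> S) (a : nat -> T -> A) (s' : nat -> T -> S)
  (theta : nat -> T -> 'cV[R]_p) (omega : nat -> T -> 'cV[R]_d)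
  (phi : nat -> T -> 'cV[R]_q)
  (Hpi : policy_class M Theta pi)
  (Hr : reward_class Phi r alpha)
  (Hfeat : feature_map feat)
  (Hexpl : sufficient_exploration M Theta pi feat)
  (Hlip : policy_lipschitz Theta pi L Sm)
  (HC : 0 < C) (HD : 0 < D)
  (Hreg : regularized_reward M Theta Phi pi r alpha L Sm C D)
  (HComega : critic_bound M Theta Phi pi r alpha feat Comega)
  (HLnu : visitation_lipschitz M Theta pi Lnu)
  (HCdelta : td_error_bound M Theta Phi pi r alpha feat Comega Cdelta)
  (Heta_theta : forall t, 0 <= eta_theta t)
  (Homega0 : enorm omega0 <= Comega)
  (Hrun : actor_critic M Theta Phi pi r alpha feat Comega eta_theta eta_omega
            theta0 omega0 phi0 Pr F s a s' theta omega phi)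
  (t : nat) :
  (\int[Pr]_w l1dist (refS M)
       (sampling_density M pi (fun k => theta k w) t)
       (visitation M (pi (theta t w)))
   <= (L * Cdelta * Lnu *
         \sum_(k < t) disc M ^+ (t - 1 - k) * eta_theta k)%:E
      + (disc M ^+ t)%:E *
        l1dist (refS M) (EFin \o init M) (visitation M (pi theta0)))%E.
Proof.
have g0 := ltW (andP (disc_bounds M)).1; have [Lnu0 _] := HLnu.
(* A probability space has a point, and there [L] bounds the norm of a gradient. *)
have L0 : 0 <= L.
  have [w _] : exists w : T, True.
    apply: contrapT => T0; have : Pr setT = 0%E.
      rewrite (_ : setT = set0) ?measure0//.
      by apply/seteqP; split => // w _; apply: T0; exists w.
    by rewrite probability_setT => /eqP; rewrite onee_eq0.
  have [_ + _] := Hlip _ (s 0%N w) (a 0%N w) (ac_params_in Hrun 0%N w).1.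
  by apply: le_trans; exact: enorm_ge0.
pose delta k w := run_td_error M pi r alpha feat s a s' theta omega phi k w.
(* The weight of [|delta k w|] once each parameter step in the unrolled recursion is bounded by
   [L * eta_theta k * |delta k w|]. *)
pose c k := disc M ^+ (t - 1 - k) * (Lnu * (L * eta_theta k)).
have c0 k : 0 <= c k by rewrite mulr_ge0 ?exprn_ge0// !mulr_ge0.
(* Every run starts from [theta0], so the initial-distance term is the same constant for all [w]. *)
pose K := ((disc M ^+ t)%:E *
  l1dist (refS M) (EFin \o init M) (visitation M (pi theta0)))%E.
have K0 : (0 <= K)%E by rewrite mule_ge0 ?l1dist_ge0// lee_fin exprn_ge0.
have pathwise w : (l1dist (refS M) (sampling_density M pi (fun k => theta k w) t)
    (visitation M (pi (theta t w))) <=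
    \sum_(k < t) (c k)%:E * `|delta k w|%:E + K)%E.
  have := l1dist_sampling_visitation Hpi t HLnu
    (th := fun k => theta k w) (fun k => (ac_params_in Hrun k w).1).
  have [-> _ _] := ac_params_init Hrun w.
  move=> /le_trans; apply; rewrite leeD2r// sumEFin lee_fin.
  apply: ler_sum => k _; rewrite /c -mulrA ler_wpM2l ?exprn_ge0// -mulrA.
  rewrite ler_wpM2l//.
  exact: (enorm_theta_step Hrun w (Heta_theta k) Hlip).
have mdelta k : measurable_fun setT (fun w => `|delta k w|%:E).
  apply/measurable_EFinP; apply: measurableT_comp => //.
  exact: (measurable_run_td_error Hpi Hr Hfeat Hrun).
have mterm k : measurable_fun setT (fun w => (c k)%:E * `|delta k w|%:E)%E.
  exact: emeasurable_funM.
have term0 k w : (0 <= (c k)%:E * `|delta k w|%:E)%E.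
  by rewrite -EFinM lee_fin mulr_ge0.
apply: le_trans (ge0_le_integral_any _ _ pathwise) _.
  by move=> w; exact: l1dist_ge0.
rewrite ge0_integralD//; last 2 first.
- by move=> w _; exact: sume_ge0.
- by apply: emeasurable_sum => k; exact: mterm.
rewrite integral_cst//= probability_setT mule1 leeD2r//.
rewrite ge0_integral_sum// mulr_sumr -sumEFin; apply: lee_sum => k _.
rewrite ge0_integralZl ?lee_fin//.
have -> : L * Cdelta * Lnu * (disc M ^+ (t - 1 - k) * eta_theta k) = c k * Cdelta.
  by rewrite /c; ring.
rewrite [leRHS]EFinM lee_wpmul2l ?lee_fin//.
exact: (first_moment_run_td_error Hpi Hr Hfeat HCdelta Homega0 Hrun).
Qed.
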